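(* Let $X=\overline{\bigoplus_{n=1}^{\infty}X_n}$ be a Schauder decomposition of a Banach space $X$ (over $\mathbb K\in\{\mathbb R,\mathbb C\}$), and let $P_m:X\to Y_m:=X_1\oplus\cdots\oplus X_m$ denote the corresponding partial-sum projections. Assume that $\|f\circ(\operatorname{Id}-P_m)\|\to 0$ as $m\to\infty$ for every $f\in X^*$, and that, for every $m\in\mathbb N$, every bounded convex subset of $Y_m$ has a countable $\pi$-base for its relative weak topology. Then every bounded convex subset of $X$ has a countable $\pi$-base for its relative weak topology.
   Context: A Schauder decomposition of $X$ is a sequence $(X_n)_{n=1}^\infty$ of closed subspaces of $X$ such that every $x\in X$ has a unique representation as a norm-convergent series $x=\sum_{n=1}^\infty x_n$ with $x_n\in X_n$, the partial-sum projections $P_m x=\sum_{n=1}^m x_n$ being bounded linear operators. A $\pi$-base for a topological space $(T,\tau)$ is a family $\mathcal U$ of nonempty open subsets of $T$ such that every nonempty open subset of $T$ contains some member of $\mathcal U$; the space has a countable $\pi$-base if $\mathcal U$ can be chosen countable. *)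

(* Defs.v *)
From HB Require Import structures.
From mathcomp Require Import all_boot all_order all_algebra.
From mathcomp Require Import all_classical all_reals all_analysis.
From mathcomp Require Export complex.

Set Implicit Arguments.
Unset Strict Implicit.
Unset Printing Implicit Defensive.

Import Order.TTheory GRing.Theory Num.Theory.
Import numFieldNormedType.Exports.

Local Open Scope classical_set_scope.
Local Open Scope ring_scope.

Definition pi_base (T : topologicalType) (U : set (set T)) : Prop :=
  (forall A, U A -> open A /\ A !=set0) /\
  (forall V, open V -> V !=set0 -> exists2 A, U A & A `<=` V).

Definition has_countable_pi_base (T : topologicalType) : Prop :=
  exists2 U : set (set T), pi_base U & countable U.

Section dual.
Context {K : numFieldType}.

Definition dual (X : normedModType K) : Type :=
  {f : {linear X -> K^o} | continuous f}.

(* The supremum is taken for the partial order of K: for K = C it is a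
   supremum of real numbers.  As for `sup`, a junk value (here 0) is returned
   when there is no supremum, i.e., when f is unbounded. *)
Definition opnorm (X : normedModType K) (f : X -> K) : K :=
  supremum 0 [set `|f x| | x in [set x : X | `|x| <= 1]].

(* X with the coarsest topology making every element of its dual continuous *)
Definition weak_space (X : normedModType K) : Type :=
  sup_topology (fun f : dual X => Topological.class (initial_topology (sval f))).

HB.instance Definition _ (X : normedModType K) :=
  Topological.on (weak_space X).

(* C, seen as a type, carries the subtype topology, here induced by the weak
   topology. *)
Definition bounded_convex_pi_base (X : normedModType K) : Prop :=
  forall C : set X, bounded_set C -> convex_set C ->
    has_countable_pi_base (C : set (weak_space X)).

End dual.

Section subspace.
Context {K : numFieldType} {X : normedModType K}.

Definition normed_subspace (S : submodClosed X) : Type := {x : X | x \in S}.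

Section instances.
Variable S : submodClosed X.
Local Notation Y := (normed_subspace S).

HB.instance Definition _ := SubChoice.on Y.
HB.instance Definition _ := [SubChoice_isSubLmodule of Y by <:].

Let norm (y : Y) : K := `|val y|.

Let ler_normD (x y : Y) : norm (x + y) <= norm x + norm y.
Proof. exact: ler_normD. Qed.

Let normrZ (l : K) (x : Y) : norm (l *: x) = `|l| * norm x.
Proof. exact: normrZ. Qed.

Let normr0_eq0 (x : Y) : norm x = 0 -> x = 0.
Proof. by move=> /normr0_eq0 x0; exact/val_inj. Qed.

HB.instance Definition _ :=
  Lmodule_isNormed.Build K Y ler_normD normrZ normr0_eq0.

End instances.
End subspace.

(* Indices start at 0: X_ n is the (n+1)-st space of the decomposition, and
   partial_sum_proj m and finite_sum m involve X_ 0, ..., X_ m.-1. *)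

Section schauder.
Context {K : numFieldType} {X : normedModType K}.
Variable X_ : nat -> submodClosed X.

Definition schauder_expansion (x : X) (y : nat -> X) : Prop :=
  (forall n, y n \in X_ n) /\ series y @ \oo --> x.

Definition schauder_coord (x : X) : nat -> X :=
  xget (fun=> 0) [set y | schauder_expansion x y].

Definition partial_sum_proj (m : nat) (x : X) : X :=
  \sum_(n < m) schauder_coord x n.

Record schauder_decomposition : Prop := {
  schauder_closed : forall n, closed [set x | x \in X_ n];
  schauder_unique : forall x, exists! y, schauder_expansion x y;
  schauder_linear : forall m, linear (partial_sum_proj m);
  schauder_bounded : forall m, exists M : K,
    forall x, `|partial_sum_proj m x| <= M * `|x| }.

Definition finite_sum_pred (m : nat) : {pred X} :=
  fun x => `[< exists y : nat -> X,
    (forall n, y n \in X_ n) /\ x = \sum_(n < m) y n >].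

Fact finite_sum_submod m : submod_closed (finite_sum_pred m).
Proof.
split=> [|a u v /asboolP[y [yX ->]] /asboolP[z [zX ->]]]; apply/asboolP.
  exists (fun=> 0); split=> [n|]; first exact: rpred0.
  by rewrite big1.
exists (fun n => a *: y n + z n); split=> [n|].
  by apply: rpredD; [exact: rpredZ|].
by rewrite scaler_sumr -big_split.
Qed.

HB.instance Definition _ m :=
  GRing.isSubmodClosed.Build K X (finite_sum_pred m) (finite_sum_submod m).

(* Under schauder_decomposition this sum is direct, by schauder_unique. *)
Definition finite_sum (m : nat) : submodClosed X := finite_sum_pred m.

End schauder.

(* Main.v *)
(* Let C be bounded and convex, and fix a countable pi-base of the bounded
   convex set P_m(C) for each m > 0.  The preimages in C of the members of all
   these pi-bases form a countable pi-base of C.  Indeed, each functional f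
   satisfies f (y - P_m y) -> 0 uniformly in y in C, so that a basic weak
   neighbourhood of x in C, which involves finitely many functionals, contains
   the preimage of a weak neighbourhood of P_m x in P_m(C) as soon as m is
   large. *)

From HB Require Import structures.
Require Import Defs.
From mathcomp Require Import all_boot all_order all_algebra.
From mathcomp Require Import all_classical all_reals all_analysis.
From mathcomp Require Import ring.
Import Order.TTheory GRing.Theory Num.Theory.
Import numFieldNormedType.Exports.
Local Open Scope classical_set_scope.
Local Open Scope ring_scope.

(** * Suprema of scalars and the operator norm *)

(** Nonnegative elements of [R[i]] have imaginary part zero, so the complex case reduces to the
    supremum of the real parts. *)
Lemma real_or_complex_supremums (R : realType) (K : numFieldType)
  (hK : K = R :> numFieldType \/ K = R[i] :> numFieldType) (A : set K) :
  (forall x, A x -> 0 <= x) -> has_sup A -> supremums A !=set0.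
Proof.
case: hK => E; subst K => A0 [[a Aa] [b Ab]].
  have sA : has_sup A by split; [exists a|exists b].
  exists (sup A); split; first by apply/ubP => x; exact: ub_le_sup sA.2 _.
  by move=> y yA; apply: ge_sup => //; exists a.
pose B := [set complex.Re x | x in A].
have ARe x : A x -> (x = (complex.Re x)%:C)%C.
  by move=> /A0; case: x => u v; rewrite lecE => /andP[/eqP/= -> _].
have sB : has_sup B.
  split; first by exists (complex.Re a), a.
  exists (complex.Re b) => _ [x Ax <-].
  by have := Ab x Ax; rewrite lecE => /andP[].
exists (sup B)%:C%C; split.
  move=> x Ax; rewrite (ARe x Ax) lecR.
  by apply: ub_le_sup sB.2 _ _; exists x.
move=> y Ay; rewrite lecE; apply/andP; split.
  (* The upper bound [y] lies above the real element [a], hence has imaginary part zero as well. *)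
  by have := Ay a Aa; rewrite (ARe a Aa) lecE => /andP[].
apply: ge_sup; first exact: sB.1.
by move=> _ [x Ax <-]; have := Ay x Ax; rewrite lecE => /andP[].
Qed.

(* The bound M rules out the junk value 0 of opnorm at unbounded f. *)
Lemma le_opnorm (R : realType) (K : numFieldType)
  (hK : K = R :> numFieldType \/ K = R[i] :> numFieldType)
  (X : normedModType K) (f : {linear X -> K^o}) (M : K) :
  (forall x, `|f x| <= M * `|x|) -> forall x, `|f x| <= opnorm f * `|x|.
Proof.
move=> fM x.
have [->|x0] := eqVneq x 0; first by rewrite linear0 !normr0 mulr0.
have M0 : 0 <= M.
  have x_gt0 : 0 < `|x| by rewrite normr_gt0.
  by rewrite -(pmulr_lge0 _ x_gt0); exact: le_trans (fM x).
set A := [set `|f z| | z in [set z : X | `|z| <= 1]].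
have A0 : A !=set0 by exists `|f 0|, 0; rewrite //= normr0.
have [s sA] : supremums A !=set0.
  apply: (real_or_complex_supremums R K hK); first by move=> _ [z _ <-].
  split=> //; exists M => _ [z /= z1 <-].
  by apply: le_trans (fM z) _; rewrite ler_piMr.
(* Both default cases of [supremum] are excluded: [A] is nonempty and [s] is a supremum of it. *)
have opnormA : supremums A (opnorm f).
  rewrite /opnorm /supremum -/A ifF; last by apply/negbTE/set0P.
  by apply: (@xgetPex _ 0 (supremums A)); exists s.
rewrite -ler_pdivrMr ?normr_gt0//.
apply: opnormA.1; exists (`|x|^-1 *: x) => /=.
  by rewrite normrZ normfV normr_id mulVf ?normr_eq0.
by rewrite linearZ/= normrZ normfV normr_id mulrC.
Qed.

(** The index [n] may depend on [x] and [V], so the preimages are collected over all [n].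
    Surjectivity of [q n] keeps them nonempty. *)
Lemma has_countable_pi_base_pullback (T : topologicalType)
  (S : nat -> topologicalType) (q : forall n, T -> S n) :
  (forall n, continuous (q n)) -> (forall n z, exists x, q n x = z) ->
  (forall n, has_countable_pi_base (S n)) ->
  (forall (x : T) (V : set T), nbhs x V -> exists n,
    nbhs (q n x) [set w | forall y, q n y = w -> V y]) ->
  has_countable_pi_base T.
Proof.
move=> q_cont q_surj S_pi qV.
pose U n := sval (cid2 (S_pi n)).
have U_pi n : pi_base (U n) by rewrite /U; case: cid2.
have U_countable n : countable (U n) by rewrite /U; case: cid2.
exists (\bigcup_n [set q n @^-1` A | A in U n]); last first.
  apply: bigcup_countable => // n _.
  exact: sub_countable (card_image_le _ _) (U_countable n).
split=> [_ [n _ [A UA <-]]|V oV [x Vx]].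
  have [oA [z Az]] := (U_pi n).1 A UA; split.
    by move/continuousP: (q_cont n); exact.
  by have [x qx] := q_surj n z; exists x; rewrite /preimage/= qx.
have [n] := qV x V (open_nbhs_nbhs (conj oV Vx)).
rewrite nbhsE => -[B [oB Bx] BV].
have [A UA AB] := (U_pi n).2 B oB (ex_intro _ _ Bx).
exists (q n @^-1` A); first by exists n => //; exists A.
by move=> y /AB/BV; exact.
Qed.

(** * Weak topologies, linear images and subspaces *)

Lemma weak_continuous (K : numFieldType) (X : normedModType K) (f : dual X) :
  continuous (sval f : weak_space X -> K^o).
Proof.
move=> x A fA.
have /cvg_sup /(_ f) xf := @cvg_id _ (nbhs (x : weak_space X)).
exact: xf (@initial_continuous X K^o (sval f) x A fA).
Qed.

(** The filter is arbitrary so that [F] can also be a filter of sets with a desired property, which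
    then need only be tested on single functionals. *)
Lemma cvg_weak (K : numFieldType) (X : normedModType K) (F : set_system X)
  (x : X) : Filter F ->
  (forall f : dual X, sval f @ F --> sval f x) -> F --> (x : weak_space X).
Proof.
move=> FF Fx; apply/cvg_sup => f A [B [[D oD <-] Dfx DA]].
by apply: filterS DA _; apply: (Fx f); exact: open_nbhs_nbhs.
Qed.

Lemma continuous_dual_comp (K : numFieldType) (X Y : normedModType K)
  (T : {linear X -> Y}) (f : dual Y) : continuous T -> continuous (sval f \o T).
Proof.
by move=> cT x; apply: continuous_comp; [exact: cT|exact: (svalP f)].
Qed.

Definition dual_comp (K : numFieldType) (X Y : normedModType K)
  (T : {linear X -> Y}) (cT : continuous T) (f : dual Y) : dual X :=
  exist (fun g : {linear X -> K^o} => continuous g) (sval f \o T)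
    (continuous_dual_comp K X Y T f cT).

Lemma weak_continuous_linear (K : numFieldType) (X Y : normedModType K)
  (T : {linear X -> Y}) :
  continuous T -> continuous (T : weak_space X -> weak_space Y).
Proof.
move=> cT x.
apply: (cvg_weak K Y (T @ nbhs (x : weak_space X)) (T x) _) => g.
exact: (weak_continuous K X (dual_comp K X Y T cT g)).
Qed.

Lemma convex_set_image (K : numFieldType) (X Y : normedModType K)
  (T : {linear X -> Y}) (C : set X) : convex_set C -> convex_set (T @` C).
Proof.
move=> cC _ _ l /set_mem[x Cx <-] /set_mem[y Cy <-].
apply/mem_set; exists (conv l (x : convex_lmodType X) y).
  by apply/set_mem; apply: cC; exact/mem_set.
by rewrite [LHS]linearD !linearZ.
Qed.

Lemma bounded_set_image (K : numFieldType) (X Y : normedModType K)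
  (T : {linear X -> Y}) (C : set X) :
  continuous T -> bounded_set C -> bounded_set (T @` C).
Proof.
move=> /linear_bounded_continuous/linear_boundedP/pinfty_ex_gt0[r r0 Tr].
move=> /pinfty_ex_gt0[M M0 CM].
have rM : r * M \is Num.real by rewrite realM ?gtr0_real.
exists (r * M); split=> // y rMy _ [x Cx <-].
apply: le_trans (Tr x) (le_trans _ (ltW rMy)).
by apply: ler_wpM2l (ltW r0) _ _ _; exact: CM.
Qed.

Lemma continuous_val (K : numFieldType) (X : normedModType K)
  (S : submodClosed X) : continuous (val : normed_subspace S -> X).
Proof.
apply/(linear_bounded_continuous (val : {linear normed_subspace S -> X})).
apply/linear_boundedP; exists 1; split=> // r r1 x.
by have := ler_wpM2r (normr_ge0 x) (ltW r1); rewrite mul1r.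
Qed.

(** * Partial sums as bounded operators *)

Section partial_sum.
Context {K : numFieldType} {X : normedModType K} {X_ : nat -> submodClosed X}.

Lemma partial_sum_in (hX : schauder_decomposition X_) m x :
  partial_sum_proj X_ m x \in finite_sum X_ m.
Proof.
apply/asboolP; exists (schauder_coord X_ x); split=> //.
have [y [xy _]] := schauder_unique hX x.
have : schauder_expansion X_ x (schauder_coord X_ x).
  apply: (@xgetPex _ (fun=> 0) [set y | schauder_expansion X_ x y]).
  by exists y.
by case.
Qed.

Definition partial_sum (hX : schauder_decomposition X_) (m : nat) (x : X) :
  normed_subspace (finite_sum X_ m) :=
  exist (fun z => z \in finite_sum X_ m) _ (partial_sum_in hX m x).

Lemma partial_sum_linear hX m : linear (partial_sum hX m).
Proof. by move=> a x y; apply/val_inj; exact: (schauder_linear hX m). Qed.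

HB.instance Definition _ hX m :=
  GRing.isLinear.Build K X _ _ (partial_sum hX m) (partial_sum_linear hX m).

(** The constant [M] given by [schauder_bounded] may fail to be nonnegative when [X] is trivial.
    [|M|] serves instead, since [M * |x|] is nonnegative and so equals its own norm. *)
Lemma partial_sum_bounded (hX : schauder_decomposition X_) m :
  exists2 M : K, 0 <= M & forall x, `|partial_sum_proj X_ m x| <= M * `|x|.
Proof.
have [M PM] := schauder_bounded hX m; exists `|M| => // x.
have Mx0 : 0 <= M * `|x| := le_trans (normr_ge0 _) (PM x).
by rewrite -[`|x|]normr_id -normrM ger0_norm.
Qed.

Lemma continuous_partial_sum hX m : continuous (partial_sum hX m).
Proof.
have [M M0 PM] := partial_sum_bounded hX m.
apply/(linear_bounded_continuous (partial_sum hX m)).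
apply/linear_boundedP; exists M; split=> [|r Mr x]; first exact: ger0_real.
exact: le_trans (PM x) (ler_wpM2r (normr_ge0 x) (ltW Mr)).
Qed.

End partial_sum.

(** * Uniform smallness of tails and weak neighbourhoods *)

Lemma shrinking_tail (R : realType) (K : numFieldType)
  (hK : K = R :> numFieldType \/ K = R[i] :> numFieldType)
  (X : normedModType K) (X_ : nat -> submodClosed X)
  (hX : schauder_decomposition X_) (f : dual X) :
  (fun m => opnorm (fun x => sval f (x - partial_sum_proj X_ m x)))
    @ \oo --> (0 : K) ->
  forall M e : K, 0 < M -> 0 < e -> \forall m \near \oo,
    forall y, `|y| <= M -> `|sval f (y - partial_sum_proj X_ m y)| < e.
Proof.
move=> f0 M e M0 e0.
have /pinfty_ex_gt0[r r0 fr] :=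
  (linear_boundedP (sval f)).1
    ((linear_bounded_continuous (sval f)).2 (svalP f)).
have eM : 0 < e / M by rewrite divr_gt0.
move/cvgr0Pnorm_lt: f0 => /(_ _ eM); apply: filterS => m /= fm y yM.
have [L L0 PL] := partial_sum_bounded hX m.
pose g : {linear X -> K^o} :=
  sval f \o (idfun \- (val \o partial_sum hX m)).
(* This bound depends on [m]; it only certifies that [opnorm g] is a genuine supremum. The smallness
   comes from [fm]. *)
have gL x : `|g x| <= r * (1 + L) * `|x|.
  apply: le_trans (fr (x - partial_sum_proj X_ m x)) _.
  rewrite -mulrA (ler_wpM2l (ltW r0))//.
  apply: le_trans (ler_normB _ _) _.
  by rewrite mulrDl mul1r lerD2l; exact: PL.
have gy : `|g y| <= opnorm g * `|y| := le_opnorm R K hK X g _ gL y.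
apply: le_lt_trans (gy) _.
have gM : `|opnorm g| < e / M := fm.
apply: le_lt_trans (_ : _ <= `|opnorm g| * M) _; last by rewrite -ltr_pdivlMr.
(* The sign of [opnorm g] is read off from [gy], which requires a nonzero [y]. *)
have [->|y0] := eqVneq y 0; first by rewrite normr0 mulr0 mulr_ge0// ltW.
have y_gt0 : 0 < `|y| by rewrite normr_gt0.
have g0 : 0 <= opnorm g.
  by rewrite -(pmulr_lge0 _ y_gt0); exact: le_trans (normr_ge0 _) gy.
by rewrite ger0_norm// ler_wpM2l.
Qed.

Lemma near_partial_sum (R : realType) (K : numFieldType)
  (hK : K = R :> numFieldType \/ K = R[i] :> numFieldType)
  (X : normedModType K) (X_ : nat -> submodClosed X)
  (hX : schauder_decomposition X_)
  (hshrinking : forall f : dual X,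
    (fun m => opnorm (fun x => sval f (x - partial_sum_proj X_ m x)))
      @ \oo --> (0 : K))
  (C : set X) (x : X) (V : set (weak_space X)) :
  bounded_set C -> C x -> nbhs (x : weak_space X) V ->
  \forall m \near \oo,
    nbhs (partial_sum hX m x : weak_space (normed_subspace (finite_sum X_ m)))
      [set w | forall y, C y -> partial_sum hX m y = w -> V y].
Proof.
(* The sets V satisfying the conclusion form a filter, so it suffices to treat
   the subbasic weak neighbourhoods of x, those given by a single functional;
   this is where the shrinking assumption enters. *)
pose Y m : topologicalType := weak_space (normed_subspace (finite_sum X_ m)).
pose p m : X -> Y m := partial_sum hX m.
(* [W m U] is the largest set whose preimage in [C] under [p m] lies in [U]. *)
pose W m (U : set X) : set (Y m) :=
  [set w | forall y, C y -> p m y = w -> U y].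
move=> Cb Cx; pose F : set_system X :=
  [set V | \forall m \near \oo, nbhs (p m x) (W m V)].
have FF : Filter F.
  split=> [|A B FA FB|A B AB FA].
  - by apply: nearW => m; apply: filterE => w y _ _; exact: I.
  (* Two sets may have different thresholds; asking for all large [m] gives a common index. *)
  - move: FA FB; rewrite /F/=; apply: filterS2 => m.
    apply: filterS2 => w Aw Bw y Cy yw.
    by split; [exact: Aw yw|exact: Bw yw].
  - move: FA; rewrite /F/=; apply: filterS => m; apply: filterS => w Aw y Cy yw.
    exact/AB/(Aw y).
move: V; apply: (cvg_weak K X F x FF) => f.
move: (Cb) => /pinfty_ex_gt0[M M0 CM].
apply/cvgrPdist_lt => e e0.
have e3 : 0 < e / 3 by rewrite divr_gt0.
have := shrinking_tail R K hK X X_ hX f (hshrinking f) M (e / 3) M0 e3.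
apply: filterS => m fm.
have := weak_continuous K _ (dual_comp K _ X
  (val : {linear normed_subspace (finite_sum X_ m) -> X})
  (continuous_val K X (finite_sum X_ m)) f) (p m x).
move=> /cvgrPdist_lt/(_ _ e3); apply: filterS => w /= fw y Cy yw.
rewrite -yw /= in fw.
(* The two tails are small uniformly on [C]; the middle term is small because [f] restricted to the
   range of [p m] is weakly continuous there. *)
have -> : sval f x - sval f y =
  sval f (x - partial_sum_proj X_ m x) +
  (sval f (partial_sum_proj X_ m x) - sval f (partial_sum_proj X_ m y)) -
  sval f (y - partial_sum_proj X_ m y).
  by rewrite -!linearB -linearD -linearB addrA subrK opprB addrA subrK.
have -> : e = e / 3 + e / 3 + e / 3 by field.
apply: le_lt_trans (ler_normB _ _) _; apply: ltrD; last exact/fm/CM.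
apply: le_lt_trans (ler_normD _ _) _; apply: ltrD => //; exact/fm/CM.
Qed.

Theorem proposition5p4 (R : realType) (K : numFieldType)
  (hK : K = R :> numFieldType \/ K = R[i] :> numFieldType)
  (X : completeNormedModType K) (X_ : nat -> submodClosed X)
  (hX : schauder_decomposition X_)
  (hshrinking : forall f : dual X,
    (fun m => opnorm (fun x => sval f (x - partial_sum_proj X_ m x)))
      @ \oo --> (0 : K))
  (hY : forall m, (0 < m)%N ->
    bounded_convex_pi_base (normed_subspace (finite_sum X_ m))) :
  bounded_convex_pi_base X.
Proof.
move=> C Cb Cc; pose E : set (weak_space X) := C.
(* The shift to [m.+1] is made because [hY] covers positive indices only. *)
pose q m := partial_sum hX m.+1.
pose Y m : topologicalType := weak_space (normed_subspace (finite_sum X_ m.+1)).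
pose D m : set (Y m) := q m @` C.
have qD m (x : E) : q m (val x) \in D m.
  by apply/mem_set; exists (val x) => //; exact/set_mem/(valP x).
(* Taking the image [D m] as codomain makes [r m] surjective. *)
pose r m (x : E) : D m := exist _ (q m (val x)) (qD m x).
apply: (has_countable_pi_base_pullback E D r) => [m|m z|m|x V].
- have q_cont : continuous (q m : weak_space X -> Y m).
    exact/weak_continuous_linear/continuous_partial_sum.
  have qE_cont : continuous ((q m : weak_space X -> Y m) \o
      (set_val : E -> weak_space X)).
    move=> x; apply: continuous_comp; first exact: initial_continuous.
    exact: q_cont.
  exact: (@continuous_comp_initial (D m) E (Y m) set_val (r m) qE_cont).
- have /set_mem[x Cx xz] := valP z.
  by exists (exist _ x (mem_set Cx)); exact/val_inj.
- apply: hY => //; last exact: convex_set_image.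
  by apply: bounded_set_image => //; exact: continuous_partial_sum.
- rewrite nbhsE => -[_ [[W oW <-] Wx] WV].
  have Cx : C (val x) := set_mem (valP x).
  have [m _ mW] := near_partial_sum R K hK X X_ hX hshrinking C (val x) W Cb Cx
    (open_nbhs_nbhs (conj oW Wx)).
  (* [r m] uses the partial sum of index [m.+1], which is still beyond the threshold [m]. *)
  exists m; have := mW m.+1 (leqnSn m).
  rewrite /= nbhsE => -[B [oB Bx] BW].
  apply: (@filterS _ (nbhs (r m x)) _ (set_val @^-1` B)).
    move=> w Bw y yw; apply: WV.
    by apply: BW Bw (val y) (set_mem (valP y)) _; rewrite -yw.
  apply: open_nbhs_nbhs; split; last exact: Bx.
  by exists B.
Qed.
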